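(* For every $0<\alpha\le 1/4$, define $$R_{\alpha}\triangleq h(\alpha)-\frac12 h(2\alpha)+(1-\alpha)\left[h\left(\Gamma^{-1}\left(\frac{\alpha}{1-\alpha}\right)\right)+1-\Gamma^{-1}\left(\frac{\alpha}{1-\alpha}\right)\right].$$ Then the optimal rate $R$ for unique-sum pairs satisfies $$R\le\inf_{0<\alpha\le 1/4}R_\alpha\le R_{1/4}<\frac32 .$$
   Context: $\log$ denotes the base-2 logarithm. Unique-sum pairs. For a positive integer $n$ and nonempty subsets $\mathcal X,\mathcal Y\subseteq\{0,1\}^n$, the pair $(\mathcal X,\mathcal Y)$ is an $n$-dimensional unique-sum pair if the map $(\boldsymbol x,\boldsymbol y)\mapsto \boldsymbol x+\boldsymbol y$ (componentwise integer addition, with values in $\{0,1,2\}^n$) is injective on $\mathcal X\times\mathcal Y$. Let $M(n)$ be the maximum of $|\mathcal X||\mathcal Y|$ over all $n$-dimensional unique-sum pairs $(\mathcal X,\mathcal Y)$. The optimal rate is $R\triangleq\lim_{n\to\infty}\frac1n\log M(n)$ (this limit is known to exist, by Lindström 1969). Functions. The binary entropy function is $h(p)=-p\log p-(1-p)\log(1-p)$ for $p\in[0,1]$, with $0\log 0=0$. Define $$\Gamma(\alpha)=1+h(\alpha)-2h\left(\frac{1-\sqrt{1-2\alpha}}{2}\right),\qquad \alpha\in[0,1/2].$$ The function $\Gamma$ is continuous and strictly decreasing on $[1/3,1/2]$ with $\Gamma(1/3)>1/3$ and $\Gamma(1/2)=0$; $\Gamma^{-1}$ denotes the inverse of the restriction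 of $\Gamma$ to $[1/3,1/2]$, so for $\beta\in[0,1/3]$, $\Gamma^{-1}(\beta)$ is the unique $\lambda\in[1/3,1/2]$ with $\Gamma(\lambda)=\beta$ (and in fact $\lambda\in(1/3,1/2]$). *)

(* Defs.v *)
From HB Require Import structures.
From mathcomp Require Import all_boot all_order all_algebra.
From mathcomp Require Import all_classical all_reals all_analysis.

Set Implicit Arguments.
Unset Strict Implicit.
Unset Printing Implicit Defensive.

Import Order.TTheory GRing.Theory Num.Theory.
Import numFieldNormedType.Exports.

Local Open Scope classical_set_scope.
Local Open Scope ring_scope.

(* Componentwise sum in nat, so the values lie in {0,1,2}^n (no carry, no
   reduction mod 2). *)
Definition vsum (n : nat) (x y : {ffun 'I_n -> bool}) : {ffun 'I_n -> nat} :=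
  [ffun i => (x i + y i)%N].

Definition unique_sum_pair (n : nat) (X Y : {set {ffun 'I_n -> bool}}) : Prop :=
  [/\ X != finset.set0, Y != finset.set0 &
      {in finset.setX X Y &, injective (fun p => vsum p.1 p.2)}].

Definition max_unique_sum (n : nat) : nat :=
  (\max_(P : {set {ffun 'I_n -> bool}} * {set {ffun 'I_n -> bool}} |
         `[< unique_sum_pair P.1 P.2 >]) (#|P.1| * #|P.2|))%N.

Section Rates.
Variable R : realType.
Implicit Types a b p x : R.

Definition log2 x : R := ln x / ln 2.

(* The term n = 0 is 0 / 0 = 0 and does not affect the limit. *)
Definition rate_seq (n : nat) : R := log2 (max_unique_sum n)%:R / n%:R.

(* The limit exists: max_unique_sum is supermultiplicative and
   max_unique_sum n <= 3 ^ n, so Fekete's lemma applies. *)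
Definition optimal_rate : R := lim (rate_seq n @[n --> \oo]).

(* 0 log 0 = 0 holds because of the factor 0. *)
Definition entropy2 p : R := - (p * log2 p) - (1 - p) * log2 (1 - p).

Definition Gamma a : R :=
  1 + entropy2 a - 2 * entropy2 ((1 - Num.sqrt (1 - 2 * a)) / 2).

(* Inverse of the restriction of Gamma to [1/3, 1/2]; takes the value 0 at
   points outside the range of that restriction. *)
Definition Gamma_inv : R -> R :=
  'pinv_(fun=> 0) [set l : R | 1 / 3 <= l <= 1 / 2] Gamma.

Definition rate_bound a : R :=
  entropy2 a - 1 / 2 * entropy2 (2 * a) +
  (1 - a) * (entropy2 (Gamma_inv (a / (1 - a))) + 1 - Gamma_inv (a / (1 - a))).

End Rates.

(* Main.v *)
Require Import Defs.
From mathcomp Require Import all_boot all_order all_algebra.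
From mathcomp Require Import all_classical all_reals all_analysis.
From mathcomp Require Import ring lra zify.

Import Order.TTheory GRing.Theory Num.Theory.
Import numFieldNormedType.Exports.

(** Let [h] be the binary entropy and call a pair [(x, y)] of words opposite
on a set [S] of coordinates when [x i != y i] for all [i] in [S].

Upper bound for the rate.  Complementing the words of [Y] keeps a pair
[(X, Y)] unique-sum and turns a Hamming distance [d] into [n - d], so one may
assume that at least half of the pairs of [X * Y] are at distance at least
[n / 2].  Counting in two ways the sets [S] of [k] (about [a n]) coordinates
on which a pair is opposite gives one [S] such that the set [P] of the pairs
opposite on [S] satisfies
   [#|X| #|Y| <= 2 C(n, k) / C(n / 2, k) * #|P|]
([unique_sum_bound]); the quotient of binomials has rate [h a - h (2 a) / 2].
All sums of pairs of [P] are 1 on [S], hence they are distinct on the other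
[m = n - k] coordinates.  Let [d] be the average frequency of disagreement
over [P] and over these coordinates.  Two entropy estimates hold, with
logarithms in base 2:
 - the sums take the value 1 with frequency [d], so
   [log #|P| <= m (h d + 1 - d)];
 - once the restriction of [x] to [S] is known, [x] and [y] range
   independently over a rectangle, so [log #|P| <= k + m (2 h q - d)] where
   [d = 2 q (1 - q)] and [q <= 1 / 2].
The first bound decreases in [d] on [1/3, 1], the second one increases on
[0, 1/2], and they agree at the [l] with [Gamma l = k / m].  So
[log #|P| <= m (h l + 1 - l)] whatever [d] is ([opposite_pairs_bound]).
Both estimates are proved in the form that is linear in [d] and tangent at
[l]: they are instances of Gibbs' inequality [gibbs], for the weights
[ternary_weight] and [bin2_weight] ([opposite_pairs_ternary_cost],
[opposite_pairs_coset_cost]).  For the second one the tangent comes from the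
concavity of [h q] as a function of [q (1 - q)] ([entropy_tangent]).

Strict inequality.  The function [h l + 1 - l] has maximum [log 3], reached
only at [l = 1/3], and [h (1/4) - 1/2 + (3/4) log 3 = 3/2].  Since
[Gamma (1/3) > 1/3] ([Gamma_third]), the value of [Gamma_inv] at [1/3] is not
[1/3], which makes [rate_bound (1/4)] smaller than [3/2].

Entropies are computed with natural logarithms up to the last step. *)

Local Open Scope ring_scope.

(** * Entropy in natural logarithms *)

Section Entropy.
Context {R : realType}.
Implicit Types p r x y a b : R.

Local Open Scope classical_set_scope.

Lemma le_of_is_derive (f df : R -> R) a b : a <= b ->
  (forall x, a <= x <= b -> is_derive x 1 f (df x)) ->
  (forall x, a <= x <= b -> 0 <= df x) -> f a <= f b.
Proof.
move=> ab fdf df0.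
have fdI x : x \in `]a, b[%R -> is_derive x 1 f (df x).
  by move=> /itvP xab; apply: fdf; rewrite !xab.
have fC : {within `[a, b], continuous f}.
  apply: derivable_within_continuous => x /itvP xab.
  by have /fdf[] : a <= x <= b by rewrite !xab.
have [c] := MVT_segment ab fdI fC.
move=> /itvP cab /eqP; rewrite subr_eq => /eqP ->.
by rewrite lerDr mulr_ge0 ?subr_ge0// df0// !cab.
Qed.

Definition entropy p : R := - (p * ln p) - (1 - p) * ln (1 - p).

Definition logit p : R := ln (1 - p) - ln p.

Lemma entropy2E p : entropy2 p = entropy p / ln 2.
Proof. by rewrite /entropy2 /entropy /log2; ring. Qed.

Lemma entropyC p : entropy (1 - p) = entropy p.
Proof. by rewrite /entropy subKr addrC. Qed.

Lemma entropy0 : entropy 0 = 0.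
Proof. by rewrite /entropy mul0r subr0 ln1 mulr0; ring. Qed.

Lemma ln2_gt0 : 0 < ln 2 :> R.
Proof. by rewrite ln_gt0// ltr1n. Qed.

Lemma entropy_half : entropy (1 / 2) = ln 2.
Proof.
rewrite /entropy (_ : 1 - 1 / 2 = 1 / 2); last by field.
by rewrite ln_div ?posrE// ln1; field.
Qed.

Lemma entropy_quarter : entropy (1 / 4) = 2 * ln 2 - 3 / 4 * ln 3.
Proof.
rewrite /entropy (_ : 1 - 1 / 4 = 3 / 4); last by field.
rewrite !ln_div ?posrE// ln1 (_ : 4 = 2 * 2); last by ring.
by rewrite lnM ?posrE//; field.
Qed.

(** The derivative of the difference of the two sides is [(1 - 1/x)^2]. *)
Lemma ln_le_halfB x : 1 <= x -> 2 * ln x <= x - x^-1.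
Proof.
move=> x1; rewrite -subr_ge0.
have -> : 0 = 1 - 1^-1 - 2 * ln 1 :> R by rewrite ln1 invr1; ring.
apply: (@le_of_is_derive (fun x => x - x^-1 - 2 * ln x)
  (fun x => 1 + x ^- 2 - 2 * x^-1)) => // y /andP[y1 _].
  have y0 : 0 < y by exact: lt_le_trans y1.
  have yN0 : y != 0 by rewrite gt_eqF.
  have Hl := is_derive1_ln y0.
  have Hv : is_derive y 1 (fun z : R => z^-1) (- y ^- 2 *: 1).
    exact: (@is_deriveV _ id).
  have H := is_deriveB (is_deriveB (is_derive_id y 1) Hv) (is_deriveZ 2 Hl).
  by apply: (is_derive_eq H); rewrite ?fctE /GRing.scale/=; ring.
have -> : 1 + y ^- 2 - 2 * y^-1 = (1 - y^-1) ^+ 2.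
  by rewrite -exprVn; ring.
exact: sqr_ge0.
Qed.

Lemma logit_ge0 p : 0 < p <= 1 / 2 -> 0 <= logit p.
Proof.
by move=> /andP[p0 p2]; rewrite /logit subr_ge0 ler_ln ?posrE; lra.
Qed.

(** [ln_le_halfB] at [(1 - p) / p]. *)
Lemma logit_le p : 0 < p <= 1 / 2 -> logit p <= (1 - 2 * p) / (2 * (p * (1 - p))).
Proof.
move=> /andP[p0 p2].
have q0 : 0 < 1 - p by lra.
have y1 : 1 <= (1 - p) / p by rewrite ler_pdivlMr//; lra.
have := ln_le_halfB _ y1; rewrite ln_div ?posrE// -/(logit p) => H.
rewrite -(ler_pM2l (x := 2)) //; apply: le_trans H _.
by rewrite le_eqVlt; apply/orP; left; apply/eqP; field; rewrite !gt_eqF.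
Qed.

Lemma is_derive_ln1B p : 0 < 1 - p ->
  is_derive p 1 (fun z : R => ln (1 - z)) (- (1 - p)^-1).
Proof.
move=> q0; have Hq1 := is_deriveB (is_derive_cst (1 : R) p (1 : R)) (is_derive_id p 1).
have Hl := is_derive1_ln q0.
have H := @is_derive1_comp R (@ln R) (cst 1 - id) p _ _ Hl Hq1.
by apply: (is_derive_eq H); rewrite ?fctE /GRing.scale/=; ring.
Qed.

Lemma is_derive_logit p : 0 < p < 1 ->
  is_derive p 1 logit (- (p * (1 - p))^-1).
Proof.
move=> /andP[p0 p1]; have q0 : 0 < 1 - p by rewrite subr_gt0.
have Hl := is_derive1_ln p0.
have Hq : is_derive p 1 (fun z : R => ln (1 - z)) (- (1 - p)^-1).
  exact: is_derive_ln1B.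
have H := is_deriveB Hq Hl.
by apply: (is_derive_eq H); field; rewrite !gt_eqF.
Qed.

Lemma is_derive_entropy p : 0 < p < 1 -> is_derive p 1 entropy (logit p).
Proof.
move=> /andP[p0 p1]; have q0 : 0 < 1 - p by rewrite subr_gt0.
have Hl := is_derive1_ln p0.
have Hq : is_derive p 1 (fun z : R => ln (1 - z)) (- (1 - p)^-1).
  exact: is_derive_ln1B.
have Hp := is_derive_id p (1 : R).
have Hp' := is_deriveB (is_derive_cst (1 : R) p (1 : R)) Hp.
have H := is_deriveB (is_deriveN (is_deriveM Hp Hl)) (is_deriveM Hp' Hq).
by apply: (is_derive_eq H); rewrite ?fctE /GRing.scale/= /logit; field; rewrite !gt_eqF.
Qed.

(** The function [logit p / (1 - 2 p)] is nonincreasing for [0 < p < 1/2],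
because [logit] is convex there and vanishes at [1/2]; denominators are
cleared. *)
Lemma logit_chord p r : 0 < r <= p -> p < 1 / 2 ->
  logit p * (1 - 2 * r) <= logit r * (1 - 2 * p).
Proof.
move=> /andP[r0 rp] p2.
have p1 : p < 1 by lra.
pose f x := logit p * (1 - 2 * x) - (1 - 2 * p) * logit x.
suff : f r <= f p by rewrite /f; lra.
pose df x := - (2 * logit p) + (1 - 2 * p) * (x * (1 - x))^-1.
apply: (@le_of_is_derive f df) => [||]; first exact: rp.
  move=> x /andP[rx xp].
  have Hl : is_derive x 1 logit (- (x * (1 - x))^-1).
    by apply: is_derive_logit; apply/andP; split; lra.
  have Hx := is_deriveB (is_derive_cst (1 : R) x (1 : R))
    (is_deriveZ 2 (is_derive_id x (1 : R))).
  have H := is_deriveB (is_deriveZ (logit p) Hx) (is_deriveZ (1 - 2 * p) Hl).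
  by apply: (is_derive_eq H); rewrite /df ?fctE /GRing.scale/=; ring.
move=> x /andP[rx xp].
have x0 : 0 < x * (1 - x) by apply: mulr_gt0; lra.
have p0 : 0 < p * (1 - p) by apply: mulr_gt0; lra.
have /logit_le : 0 < p <= 1 / 2 by apply/andP; split; lra.
rewrite ler_pdivlMr; last by rewrite mulr_gt0.
have le_xp : x * (1 - x) <= p * (1 - p) by nra.
move=> H.
rewrite /df addrC subr_ge0 ler_pdivlMr //.
have : 0 <= logit p by apply: logit_ge0; apply/andP; split; lra.
nra.
Qed.

Lemma logit_ge p : 0 < p < 1 / 2 -> 1 - 2 * p <= logit p.
Proof.
move=> /andP[p0 p2].
have q0 : 0 < 1 - p by lra.
have : ln (1 + (p / (1 - p) - 1)) <= p / (1 - p) - 1.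
  by apply: le_ln1Dx; rewrite ltrBDl subrr divr_gt0.
rewrite addrC subrK ln_div ?posrE // -opprB -/(logit p).
have -> : p / (1 - p) - 1 = - ((1 - 2 * p) / (1 - p)).
  by field; rewrite gt_eqF.
rewrite lerN2; apply: le_trans.
rewrite ler_pdivlMr //; nra.
Qed.

(** As a function of [r (1 - r)] the entropy is concave, with derivative
[logit r / (1 - 2 r)]; the right-hand side is its tangent at [p (1 - p)].
The difference of the two sides, as a function of [r], decreases up to [p] and
increases from [p] to [1/2] by [logit_chord]. *)
Lemma entropy_tangent p r : 0 < p < 1 / 2 -> 0 <= r <= 1 ->
  entropy r <= entropy p + logit p / (1 - 2 * p) * (r * (1 - r) - p * (1 - p)).
Proof.
move=> /andP[p0 p2]; wlog r2 : r / r <= 1 / 2 => [hw|/andP[r0 r1]].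
  move=> /andP[r0 r1]; have [|r2] := leP r (1 / 2).
    by move=> /hw; apply; rewrite r0.
  have := hw (1 - r); rewrite entropyC subKr (mulrC (1 - r)); apply; first lra.
  by apply/andP; split; lra.
have d0 : 0 < 1 - 2 * p by lra.
set c := logit p / (1 - 2 * p).
have lE : logit p = c * (1 - 2 * p) by rewrite /c divfK // gt_eqF.
have l0 : 0 <= logit p by apply: logit_ge0; apply/andP; split; lra.
have c0 : 0 <= c by rewrite divr_ge0 // ltW.
have [r0'|r0'] := ltP 0 r; last first.
  (* At r = 0 the entropy is not differentiable; there the bound follows from
     - ln (1 - p) >= p and logit_le. *)
  have -> : r = 0 by lra.
  rewrite entropy0.
  have q0 : 0 < 1 - p by lra.
  have : ln (1 + - p) <= - p by apply: le_ln1Dx; lra.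
  have /logit_le : 0 < p <= 1 / 2 by apply/andP; split; lra.
  rewrite lE ler_pdivlMr; last by rewrite !mulr_gt0.
  move=> H1 H2.
  have -> : entropy p = - ln (1 - p) + p * logit p by rewrite /entropy /logit; ring.
  rewrite lE.
  have H3 : c * (2 * (p * (1 - p))) <= 1.
    rewrite -(ler_pM2l d0) mulr1; apply: le_trans H1.
    by rewrite le_eqVlt; apply/orP; left; apply/eqP; ring.
  nra.
pose f x := c * (x * (1 - x)) - entropy x.
have df x : 0 < x < 1 -> is_derive x 1 f (c * (1 - 2 * x) - logit x).
  move=> x01; have He := is_derive_entropy _ x01.
  have Hx := is_derive_id x (1 : R).
  have Hx' := is_deriveB (is_derive_cst (1 : R) x (1 : R)) Hx.
  have H := is_deriveB (is_deriveZ c (is_deriveM Hx Hx')) He.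
  by apply: (is_derive_eq H); rewrite ?fctE /GRing.scale/=; ring.
suff : f p <= f r by rewrite /f; lra.
have [rp|pr] := leP r p.
  rewrite -lerN2.
  apply: (@le_of_is_derive (fun x => - f x)
    (fun x => - (c * (1 - 2 * x) - logit x))); first exact: rp.
    move=> x /andP[rx xp]; apply: is_deriveN; apply: df; apply/andP; split; lra.
  move=> x /andP[rx xp]; have x0 : 0 < x <= p by apply/andP; split; lra.
  have := logit_chord _ _ x0 p2; rewrite lE; nra.
apply: (@le_of_is_derive f (fun x => c * (1 - 2 * x) - logit x)).
  exact: ltW.
  by move=> x /andP[rx xp]; apply: df; apply/andP; split; lra.
move=> x /andP[px xr]; have [x2|x2] := ltP x (1 / 2).
  have pp : 0 < p <= x by apply/andP; split; lra.
  have := logit_chord _ _ pp x2; rewrite lE; nra.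
have -> : x = 1 / 2 by lra.
by rewrite /logit; rewrite (_ : 1 - 1 / 2 = 1 / 2); lra.
Qed.

Lemma continuous_entropy (p : R) : 0 < p < 1 -> {for p, continuous entropy}.
Proof.
move=> /is_derive_entropy[dp _].
by apply/differentiable_continuous/derivable1_diffP.
Qed.

End Entropy.

(** * Gibbs' inequality and weights on sums of words *)

Section Gibbs.
Context {R : realType}.

Lemma ln_prod (I : finType) (P : pred I) (F : I -> R) :
  (forall i, P i -> 0 < F i) ->
  ln (\prod_(i | P i) F i) = \sum_(i | P i) ln (F i).
Proof.
move=> F0; suff [] : 0 < \prod_(i | P i) F i /\
  ln (\prod_(i | P i) F i) = \sum_(i | P i) ln (F i) by [].
elim/big_rec2: _ => [|i u v Pi [v0 uv]]; first by rewrite ln1.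
by rewrite mulr_gt0 ?F0// lnM ?posrE ?F0// uv.
Qed.

(** The uniform law on [W] has entropy [ln #|W|], and coding it with the
weights [q] costs at least that much. *)
Lemma gibbs (T : finType) (W : {set T}) (q : T -> R) :
  (forall t, t \in W -> 0 < q t) -> \sum_(t in W) q t <= 1 ->
  #|W|%:R * ln (#|W|%:R : R) <= \sum_(t in W) - ln (q t).
Proof.
move=> q0 q1; have [W0|W0] := posnP #|W|.
  by rewrite W0 mul0r big1 // => t; move/cards0_eq: W0 => ->; rewrite inE.
set N : R := #|W|%:R; have N0 : 0 < N by rewrite ltr0n.
suff : \sum_(t in W) (ln N + ln (q t)) <= 0.
  rewrite big_split/= sumr_const -[_ *+ _]mulr_natl sumrN -/N; lra.
apply: (@le_trans _ _ (\sum_(t in W) (N * q t - 1))).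
  apply: ler_sum => t tW; rewrite -lnM ?posrE ?q0//.
  rewrite -[X in ln X](subrKC 1); apply: le_ln1Dx.
  by rewrite ltrBDl subrr mulr_gt0// q0.
rewrite sumrB -mulr_sumr sumr_const -/N.
nra.
Qed.

Section Words.
Context {n : nat}.
Local Notation word := {ffun 'I_n -> bool}.
Implicit Types (S : {set 'I_n}) (P : {set word * word}) (Q : 'I_n -> nat -> R).

Lemma vsum_lt3 (x y : word) i : (vsum x y i < 3)%N.
Proof. by rewrite ffunE; case: (x i); case: (y i). Qed.

(** Distinct sums are distinct words over {0, 1, 2}, and the total weight of
all these words is the product of the weights of the coordinates.  On [S] the
sums are constant, so these coordinates contribute nothing. *)
Lemma sum_weight_le1 S P Q :
  {in P &, injective (fun p => vsum p.1 p.2)} ->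
  (forall p i, p \in P -> i \in S -> vsum p.1 p.2 i = 1%N) ->
  (forall i j, 0 <= Q i j) -> (forall i, Q i 0%N + Q i 1%N + Q i 2%N = 1) ->
  \sum_(p in P) \prod_(i | i \notin S) Q i (vsum p.1 p.2 i) <= 1.
Proof.
move=> Pinj PS Q0 Q1.
pose Q' i (j : 'I_3) := if i \in S then (j == 1%N :> nat)%:R else Q i j.
have Q'0 i j : 0 <= Q' i j by rewrite /Q'; case: ifP => // _; rewrite ler0n.
pose f (p : word * word) : {ffun 'I_n -> 'I_3} := [ffun i => inord (vsum p.1 p.2 i)].
have fE p i : f p i = vsum p.1 p.2 i :> nat by rewrite ffunE inordK// vsum_lt3.
have finj : {in P &, injective f}.
  move=> p q pP qP fpq; apply: Pinj => //; apply/ffunP => i.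
  by rewrite -!fE fpq.
have -> : \sum_(p in P) \prod_(i | i \notin S) Q i (vsum p.1 p.2 i) =
    \sum_(t in f @: P) \prod_i Q' i (t i).
  rewrite big_imset//=; apply: eq_bigr => p pP.
  rewrite big_mkcond/=; apply: eq_bigr => i _; rewrite /Q' fE.
  by case: (boolP (i \in S)) => //= iS; rewrite PS.
apply: (@le_trans _ _ (\sum_(t : {ffun 'I_n -> 'I_3}) \prod_i Q' i (t i))).
  rewrite [leRHS](bigID (mem (f @: P)))/= lerDl sumr_ge0// => t _.
  exact: prodr_ge0.
rewrite -(bigA_distr_bigA Q') big1// => i _.
rewrite !big_ord_recl big_ord0 /= /Q'; case: (i \in S) => //=.
  by rewrite addr0 add0r addr0.
by rewrite addr0 addrA Q1.
Qed.

End Words.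

(** The law of the sum of two independent bits of mean [r]. *)
Definition bin2_weight (r : R) (s : nat) : R :=
  if s is 0 then (1 - r) ^+ 2 else if s is 1 then 2 * (r * (1 - r)) else r ^+ 2.

(** The law with [P(1) = l] that is uniform on {0, 2}; it has the largest
entropy among those with [P(1) = l]. *)
Definition ternary_weight (l : R) (s : nat) : R := if s is 1 then l else (1 - l) / 2.

Lemma bin2_weight_ge0 (r : R) s : 0 <= r <= 1 -> 0 <= bin2_weight r s.
Proof.
move=> /andP[r0 r1]; case: s => [|[|s]] /=; rewrite ?sqr_ge0//.
by rewrite !mulr_ge0// subr_ge0.
Qed.

Lemma ln_bin2_weight (r : R) (a b : bool) :
  (a || b -> 0 < r) -> (~~ a || ~~ b -> r < 1) ->
  0 < bin2_weight r (a + b) /\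
  - ln (bin2_weight r (a + b)) = (a%:R + b%:R) * - ln r
    + (2 - (a%:R + b%:R)) * - ln (1 - r) - (a != b)%:R * ln 2.
Proof.
case: a; case: b => /= Ha Hb.
- have r0 := Ha erefl; split; first by rewrite exprn_gt0.
  by rewrite lnXn// -mulr_natl; ring.
- have r0 := Ha erefl; have r1 : 0 < 1 - r by rewrite subr_gt0 Hb.
  split; first by rewrite !mulr_gt0.
  by rewrite !lnM ?posrE ?mulr_gt0//; ring.
- have r0 := Ha erefl; have r1 : 0 < 1 - r by rewrite subr_gt0 Hb.
  split; first by rewrite !mulr_gt0.
  by rewrite !lnM ?posrE ?mulr_gt0//; ring.
- have r1 : 0 < 1 - r by rewrite subr_gt0 Hb.
  split; first by rewrite exprn_gt0.
  by rewrite lnXn// -mulr_natl; ring.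
Qed.

Section Rectangle.
Context {T : finType} (A B : {set T}) (f : T -> bool).

(** The parameter [r] for which coding the sums over [A * B] with
[bin2_weight r] is the cheapest. *)
Definition mean_bit : R :=
  ((\sum_(x in A) (f x)%:R) / #|A|%:R + (\sum_(y in B) (f y)%:R) / #|B|%:R) / 2.

Let freq (C : {set T}) : R := (\sum_(x in C) (f x)%:R) / #|C|%:R.

Let freq_ge0 C : 0 <= freq C.
Proof. by rewrite divr_ge0 ?sumr_ge0. Qed.

Let freq_le1 C : freq C <= 1.
Proof.
have [C0|C0] := posnP #|C|; first by rewrite /freq C0 invr0 mulr0.
rewrite ler_pdivrMr ?ltr0n// mul1r -[leRHS]mulr1 mulr_natl -sumr_const.
by apply: ler_sum => x _; rewrite lern1 leq_b1.
Qed.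

Let freq_gt0 (C : {set T}) x : x \in C -> f x -> 0 < freq C.
Proof.
move=> xC fx; rewrite divr_gt0// ?ltr0n; last by apply/card_gt0P; exists x.
by rewrite (bigD1 x)//= fx ltr_pwDl// sumr_ge0.
Qed.

Let freq_lt1 (C : {set T}) x : x \in C -> ~~ f x -> freq C < 1.
Proof.
move=> xC fx; rewrite ltr_pdivrMr ?ltr0n; last by apply/card_gt0P; exists x.
rewrite mul1r -[ltRHS]mulr1 mulr_natl -sumr_const (bigD1 x)//= (negbTE fx) add0r.
rewrite [ltRHS](bigD1 x)//= ltr_pwDl// ler_sum// => y _.
by rewrite lern1 leq_b1.
Qed.

Lemma mean_bit_itv : 0 <= mean_bit <= 1.
Proof.
rewrite /mean_bit -/(freq A) -/(freq B).
have := freq_ge0 A; have := freq_ge0 B; have := freq_le1 A; have := freq_le1 B.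
lra.
Qed.

Lemma ln_mean_bit_weight x y : x \in A -> y \in B ->
  0 < bin2_weight mean_bit (f x + f y) /\
  - ln (bin2_weight mean_bit (f x + f y)) = ((f x)%:R + (f y)%:R) * - ln mean_bit
    + (2 - ((f x)%:R + (f y)%:R)) * - ln (1 - mean_bit) - (f x != f y)%:R * ln 2.
Proof.
move=> xA yB; apply: ln_bin2_weight; rewrite /mean_bit -/(freq A) -/(freq B).
  have := freq_ge0 A; have := freq_ge0 B.
  by move=> ? ? /orP[/(freq_gt0 _ _ xA)|/(freq_gt0 _ _ yB)]; lra.
have := freq_le1 A; have := freq_le1 B.
by move=> ? ? /orP[/(freq_lt1 _ _ xA)|/(freq_lt1 _ _ yB)]; lra.
Qed.

(** Let [a] and [b] be the frequencies of [f] in [A] and [B] and [r] their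
mean.  Coding the sum of the two bits with [bin2_weight r] costs
[2 entropy r - d ln 2] on average, where [d = a + b - 2 a b] is the frequency of
disagreement.  Now [2 r (1 - r) <= d], because [a b <= r ^ 2], and
[entropy_tangent] bounds [entropy r] by an affine function of [2 r (1 - r)]
with slope [c / 2 >= 0]. *)
Lemma rectangle_cost p c : 0 < p < 1 / 2 -> c = logit p / (1 - 2 * p) ->
  \sum_(x in A) \sum_(y in B) - ln (bin2_weight mean_bit (f x + f y)) <=
  #|A|%:R * #|B|%:R * (2 * entropy p - c * (2 * (p * (1 - p)))) +
  (c - ln 2) * \sum_(x in A) \sum_(y in B) (f x != f y)%:R.
Proof.
move=> p01 cE.
have [A0|A0] := posnP #|A|.
  have E x : (x \in A) = false by move/cards0_eq: A0 => ->; rewrite inE.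
  by rewrite A0 !big_pred0// !mul0r mulr0 addr0.
have [B0|B0] := posnP #|B|.
  have E x : (x \in B) = false by move/cards0_eq: B0 => ->; rewrite inE.
  have big0 g : \sum_(x in A) \sum_(y in B) g x y = 0 :> R.
    by rewrite big1// => x _; rewrite big_pred0.
  by rewrite B0 !big0 mulr0 mul0r mulr0 addr0.
set r := mean_bit; set NA : R := #|A|%:R; set NB : R := #|B|%:R.
have NA0 : 0 < NA by rewrite ltr0n.
have NB0 : 0 < NB by rewrite ltr0n.
pose a := \sum_(x in A) (f x)%:R : R; pose b := \sum_(y in B) (f y)%:R : R.
have sum_lin (u v w z : R) :
    \sum_(x in A) \sum_(y in B) (u + v * (f x)%:R + w * (f y)%:R
       + z * ((f x)%:R * (f y)%:R)) =
    u * NA * NB + v * a * NB + w * NA * b + z * a * b.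
  have sum_aff (C : {set T}) K L : \sum_(x in C) (K + L * (f x)%:R) =
      K * #|C|%:R + L * \sum_(x in C) (f x)%:R :> R.
    by rewrite big_split/= -mulr_sumr sumr_const mulr_natr.
  transitivity (\sum_(x in A) ((u * NB + w * b) + (v * NB + z * b) * (f x)%:R)).
    apply: eq_bigr => x _.
    transitivity (\sum_(y in B) ((u + v * (f x)%:R) + (w + z * (f x)%:R) * (f y)%:R)).
      by apply: eq_bigr => y _; ring.
    by rewrite sum_aff -/NB -/b; ring.
  by rewrite sum_aff -/NA -/a; ring.
set D := \sum_(x in A) \sum_(y in B) (f x != f y)%:R.
have DE : D = a * NB + NA * b - 2 * a * b.
  transitivity (\sum_(x in A) \sum_(y in B) (0 + 1 * (f x)%:R + 1 * (f y)%:R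
       + - 2 * ((f x)%:R * (f y)%:R)) : R).
    apply: eq_bigr => x _; apply: eq_bigr => y _.
    by case: (f x); case: (f y) => /=; ring.
  by rewrite sum_lin; ring.
have rE : 2 * r * (NA * NB) = a * NB + NA * b.
  by rewrite /r /mean_bit -/NA -/NB -/a -/b; field; rewrite !gt_eqF.
have -> : \sum_(x in A) \sum_(y in B) - ln (bin2_weight r (f x + f y)) =
    NA * NB * (2 * entropy r) - ln 2 * D.
  rewrite /D mulr_sumr.
  transitivity (\sum_(x in A) \sum_(y in B) (- 2 * ln (1 - r) +
       (ln (1 - r) - ln r) * (f x)%:R + (ln (1 - r) - ln r) * (f y)%:R
       + 0 * ((f x)%:R * (f y)%:R)) - \sum_(x in A) (ln 2 *
           \sum_(y in B) (f x != f y)%:R)).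
    rewrite -sumrB; apply: eq_bigr => x xA; rewrite mulr_sumr -sumrB.
    apply: eq_bigr => y yB; rewrite (ln_mean_bit_weight _ _ xA yB).2 -/r; ring.
  congr (_ - _); rewrite sum_lin.
  transitivity (- 2 * ln (1 - r) * NA * NB + (ln (1 - r) - ln r) * (2 * r * (NA * NB))).
    by rewrite rE; ring.
  by rewrite /entropy; ring.
have Hr := entropy_tangent p r p01 mean_bit_itv; rewrite -cE in Hr.
have c0 : 0 <= c.
  rewrite cE; apply: divr_ge0; last lra.
  by apply: logit_ge0; apply/andP; lra.
have Dge : NA * NB * (2 * (r * (1 - r))) <= D.
  rewrite -(ler_pM2l (mulr_gt0 NA0 NB0)) DE -subr_ge0.
  have -> : NA * NB * (a * NB + NA * b - 2 * a * b)
      - NA * NB * (NA * NB * (2 * (r * (1 - r)))) =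
      (2 * r * (NA * NB)) ^+ 2 / 2 - 2 * (NA * NB * a * b).
    by rewrite -rE; field.
  have -> : (2 * r * (NA * NB)) ^+ 2 / 2 - 2 * (NA * NB * a * b) =
      (a * NB - NA * b) ^+ 2 / 2.
    by rewrite rE; field.
  by rewrite divr_ge0// sqr_ge0.
have := ler_wpM2l c0 Dge.
have := ler_wpM2l (mulr_ge0 (ltW NA0) (ltW NB0)) Hr.
lra.
Qed.

End Rectangle.

End Gibbs.

(** * Pairs that disagree on a given set of coordinates *)

Section Cosets.
Context {R : realType} {n : nat}.
Local Notation word := {ffun 'I_n -> bool}.
Implicit Types (x y : word) (p : word * word).

Definition disagree x y : {set 'I_n} := [set i | x i != y i].

Variables (X Y : {set word}) (S : {set 'I_n}).
Hypothesis XYinj : {in finset.setX X Y &, injective (fun p => vsum p.1 p.2)}.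

Definition opposite_pairs : {set word * word} :=
  [set p in finset.setX X Y | S \subset disagree p.1 p.2].
Local Notation P := opposite_pairs.

Lemma in_opposite_pairs p : (p \in P) =
  [&& p.1 \in X, p.2 \in Y & S \subset disagree p.1 p.2].
Proof. by rewrite finset.in_set; case: p => x y; rewrite finset.in_setX andbA. Qed.

Let m : R := #|~: S|%:R.
Let D : R := \sum_(p in P) \sum_(i | i \notin S) (p.1 i != p.2 i)%:R.

Let Pinj : {in P &, injective (fun p => vsum p.1 p.2)}.
Proof.
move=> [x y] [x' y']; rewrite !in_opposite_pairs => /and3P[xX yY _] /and3P[xX' yY' _].
by apply: XYinj; apply/finset.setXP.
Qed.

Let PS p i : p \in P -> i \in S -> vsum p.1 p.2 i = 1%N.
Proof.
rewrite in_opposite_pairs => /and3P[_ _ /fintype.subsetP H] /H; rewrite inE ffunE.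
by case: (p.1 i); case: (p.2 i).
Qed.

Let sum_aff (K L : R) :
  \sum_(p in P) \sum_(i | i \notin S) (K + L * (p.1 i != p.2 i)%:R) =
  #|P|%:R * m * K + L * D.
Proof.
rewrite /D mulr_sumr.
transitivity (\sum_(p in P) (m * K + L * \sum_(i | i \notin S) (p.1 i != p.2 i)%:R)).
  apply: eq_bigr => p _; rewrite big_split/= -mulr_sumr sumr_const mulr_natl.
  by congr (_ *+ _ + _); apply: eq_card => i; rewrite !inE.
by rewrite big_split/= sumr_const -mulrA mulr_natl.
Qed.

(** The entropy of the sums outside [S], estimated with [ternary_weight l]. *)
Lemma opposite_pairs_ternary_cost (l : R) : 0 < l < 1 ->
  #|P|%:R * ln (#|P|%:R : R) <=
  #|P|%:R * m * (ln 2 - ln (1 - l)) + (ln (1 - l) - ln l - ln 2) * D.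
Proof.
move=> /andP[l0 l1]; have l1' : 0 < 1 - l by rewrite subr_gt0.
have w0 s : 0 < ternary_weight l s.
  by rewrite /ternary_weight; case: s => [|[|s]]//; rewrite divr_gt0.
have := @gibbs R _ P (fun p => \prod_(i | i \notin S) ternary_weight l (vsum p.1 p.2 i)).
rewrite -sum_aff.
have -> : \sum_(p in P) - ln (\prod_(i | i \notin S) ternary_weight l (vsum p.1 p.2 i)) =
  \sum_(p in P) \sum_(i | i \notin S)
   (ln 2 - ln (1 - l) + (ln (1 - l) - ln l - ln 2) * (p.1 i != p.2 i)%:R).
  apply: eq_bigr => p _; rewrite ln_prod// -sumrN; apply: eq_bigr => i _.
  rewrite /ternary_weight ffunE.
  by case: (p.1 i); case: (p.2 i) => /=; rewrite ?ln_div ?posrE//; ring.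
apply; first by move=> p _; apply: prodr_gt0.
apply: (sum_weight_le1 S P (fun _ => ternary_weight l)) => //.
  by move=> i j; apply: ltW.
by move=> i /=; field.
Qed.

(** For [k] a subset of [S], the pairs of [P] whose first word has trace [k]
on [S] form the rectangle [left_coset k * right_coset k]. *)
Let supp x : {set 'I_n} := [set i | x i].
Let left_coset (k : {set 'I_n}) := [set x in X | S :&: supp x == k].
Let right_coset (k : {set 'I_n}) := [set y in Y | S :&: supp y == S :\: k].

Let fiber k p : k \in powerset S ->
  (p \in P) && (S :&: supp p.1 == k) = (p \in finset.setX (left_coset k) (right_coset k)).
Proof.
rewrite in_opposite_pairs !inE => kS; rewrite -!andbA; case: (p.1 \in X) => //=.
case: (p.2 \in Y) => //=; last by rewrite !andbF.
rewrite andbC; case: eqP => //= pk; apply/fintype.subsetP/eqP => [H|H].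
  apply/finset.setP => i; rewrite -pk !inE; case: (boolP (i \in S)) => //= /H.
  by rewrite inE; case: (p.1 i); case: (p.2 i).
move=> i iS; move/finset.setP/(_ i): H; rewrite -pk !inE iS/=.
by case: (p.1 i); case: (p.2 i).
Qed.

Let sum_fibers (F : word * word -> R) :
  \sum_(p in P) F p = \sum_(k in powerset S)
    \sum_(x in left_coset k) \sum_(y in right_coset k) F (x, y).
Proof.
rewrite (partition_big (fun p => S :&: supp p.1) (mem (powerset S)))/=; last first.
  by move=> p _; rewrite inE finset.subsetIl.
apply: eq_bigr => k kS; rewrite pair_big/=; apply: eq_big => [p|[]//].
by rewrite fiber//; case: p => x y; rewrite finset.in_setX.
Qed.

(** A pair of [P] is coded by the trace on [S] of its first word, uniformly
among the subsets of [S], and then by its sum, coordinate by coordinate, with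
weights adapted to the rectangle that the trace determines. *)
Lemma opposite_pairs_coset_cost (p c : R) :
  0 < p < 1 / 2 -> c = logit p / (1 - 2 * p) ->
  #|P|%:R * ln (#|P|%:R : R) <= #|P|%:R * (#|S|%:R * ln 2)
    + #|P|%:R * m * (2 * entropy p - c * (2 * (p * (1 - p)))) + (c - ln 2) * D.
Proof.
move=> p01 cE.
pose r k i : R := mean_bit (left_coset k) (right_coset k) (fun x => x i).
pose w (k : {set 'I_n}) (u : word * word) :=
  \prod_(i | i \notin S) bin2_weight (r k i) (vsum u.1 u.2 i).
pose q (u : word * word) := 2 ^- #|S| * w (S :&: supp u.1) u.
have key k x : x \in left_coset k -> S :&: supp x = k.
  by rewrite inE => /andP[_ /eqP].
have pow0 : 0 < 2 ^- #|S| :> R by rewrite invr_gt0 exprn_gt0.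
have Hw k x y i : x \in left_coset k -> y \in right_coset k ->
    0 < bin2_weight (r k i) (vsum x y i).
  move=> xk yk; rewrite ffunE.
  by have [] := @ln_mean_bit_weight R _ _ _ (fun x : word => x i) _ _ xk yk.
have q0 u : u \in P -> 0 < q u.
  case: u => x y uP; rewrite mulr_gt0//; apply: prodr_gt0 => i _.
  have : ((x, y) \in P) && (S :&: supp x == S :&: supp x) by rewrite uP eqxx.
  rewrite fiber ?powersetE ?finset.subsetIl// => /finset.setXP[].
  exact: Hw.
have q1 : \sum_(u in P) q u <= 1.
  rewrite (partition_big (fun p => S :&: supp p.1) (mem (powerset S)))/=; last first.
    by move=> u _; rewrite inE finset.subsetIl.
  apply: (@le_trans _ _ (\sum_(k in powerset S) 2 ^- #|S|)); last first.
    rewrite sumr_const card_powerset -[_ *+ _]mulr_natl natrX mulfV ?lexx//.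
  apply: ler_sum => k kS.
  pose Pk := [set u in P | S :&: supp u.1 == k].
  have PkE u : (u \in Pk) = (u \in P) && (S :&: supp u.1 == k).
    by rewrite [LHS]finset.in_set.
  have -> : \sum_(u in P | S :&: supp u.1 == k) q u =
      2 ^- #|S| * \sum_(u in Pk) w k u.
    rewrite mulr_sumr.
    apply: eq_big => [u|u /andP[_ /eqP uk]]; first by rewrite PkE.
    by rewrite /q uk.
  apply: ler_piMr; first exact: ltW.
  have PkP : {subset Pk <= P} by move=> u; rewrite PkE => /andP[].
  apply: (sum_weight_le1 S Pk (fun i => bin2_weight (r k i))).
  - by move=> u v /PkP uP /PkP vP; apply: Pinj.
  - by move=> u i /PkP uP iS; apply: PS.
  - by move=> i j; apply: bin2_weight_ge0; apply: mean_bit_itv.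
  - by move=> i /=; ring.
apply: le_trans (gibbs _ _ q q0 q1) _.
pose K : R := 2 * entropy p - c * (2 * (p * (1 - p))).
have -> : #|P|%:R * (#|S|%:R * ln 2) + #|P|%:R * m * K + (c - ln 2) * D =
  \sum_(u in P) (#|S|%:R * ln 2 +
    \sum_(i | i \notin S) (K + (c - ln 2) * (u.1 i != u.2 i)%:R)).
  by rewrite big_split/= sum_aff sumr_const -[(_ * _) *+ _]mulr_natl addrA.
rewrite !sum_fibers; apply: ler_sum => k kS.
set A := left_coset k; set B := right_coset k.
have -> : \sum_(x in A) \sum_(y in B) - ln (q (x, y)) =
  \sum_(x in A) \sum_(y in B) (#|S|%:R * ln 2)
  + \sum_(i | i \notin S) \sum_(x in A) \sum_(y in B)
      - ln (bin2_weight (r k i) (x i + y i)).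
  rewrite [X in _ = _ + X]exchange_big/= -big_split; apply: eq_bigr => x xA.
  rewrite [X in _ = _ + X]exchange_big/= -big_split; apply: eq_bigr => y yB /=.
  rewrite /q /w (key _ _ xA) lnM ?posrE ?pow0 ?prodr_gt0//; last first.
    by move=> i _; apply: Hw.
  rewrite ln_prod; last by move=> i _; apply: Hw.
  rewrite lnV ?posrE ?exprn_gt0// lnXn// opprD opprK mulr_natl -sumrN.
  by congr (_ + _); apply: eq_bigr => i _; rewrite ffunE.
have -> : \sum_(x in A) \sum_(y in B) (#|S|%:R * ln 2 +
    \sum_(i | i \notin S) (K + (c - ln 2) * ((x, y).1 i != (x, y).2 i)%:R)) =
  \sum_(x in A) \sum_(y in B) (#|S|%:R * ln 2)
  + \sum_(i | i \notin S) \sum_(x in A) \sum_(y in B)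
      (K + (c - ln 2) * (x i != y i)%:R).
  rewrite [X in _ = _ + X]exchange_big/= -big_split; apply: eq_bigr => x xA.
  by rewrite [X in _ = _ + X]exchange_big/= -big_split.
rewrite lerD2l; apply: ler_sum => i _.
apply: le_trans (rectangle_cost A B (fun x => x i) _ _ p01 cE) _.
rewrite le_eqVlt; apply/orP; left; apply/eqP; rewrite -/K.
rewrite mulr_sumr.
transitivity (\sum_(x in A)
    (#|B|%:R * K + \sum_(y in B) (c - ln 2) * (x i != y i)%:R)).
  rewrite big_split/= sumr_const -[(_ * _) *+ _]mulr_natl mulrA; congr (_ + _).
  by apply: eq_bigr => x _; rewrite mulr_sumr.
by apply: eq_bigr => x _; rewrite big_split/= sumr_const -[K *+ _]mulr_natl.
Qed.

(** The two costs are affine in the number [D] of disagreements, with slope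
of opposite signs: nonpositive for the first one because [l >= 1/3],
nonnegative for the second one because [logit p >= 1 - 2 p].  At
[D = m l #|P|] the first one is [#|P|] times the claimed exponent, and so is
the second one up to the gap assumed to be nonnegative; hence one of the two
costs suffices for each [D]. *)
Lemma opposite_pairs_bound (l p : R) :
  0 < p < 1 / 2 -> l = 2 * (p * (1 - p)) -> 1 / 3 <= l ->
  #|S|%:R * ln 2 <= m * (ln 2 + entropy l - 2 * entropy p) ->
  #|P|%:R <= expR (m * (entropy l + (1 - l) * ln 2)).
Proof.
move=> p01 lE l3 HS; have [P0|P0] := posnP #|P|; first by rewrite P0 expR_ge0.
have N0 : 0 < #|P|%:R :> R by rewrite ltr0n.
rewrite -(@lnK _ #|P|%:R) ?posrE// ler_expR -(ler_pM2l N0).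
have l2 : l < 1 / 2 by rewrite lE; nra.
have ln2_0 := @ln2_gt0 R.
have /opposite_pairs_ternary_cost H1 : 0 < l < 1 by apply/andP; split; lra.
have H2 := opposite_pairs_coset_cost _ _ p01 erefl.
set c := logit p / (1 - 2 * p) in H2; rewrite -lE in H2.
have [Dge|Dlt] := leP (#|P|%:R * m * l) D.
  apply: le_trans H1 _.
  have k0 : ln (1 - l) - ln l - ln 2 <= 0.
    rewrite -addrA -opprD subr_le0 -lnM ?posrE ?ler_ln ?posrE; lra.
  have := ler_wnM2l k0 Dge; rewrite /entropy; lra.
apply: le_trans H2 _.
have k0 : 0 <= c - ln 2.
  rewrite subr_ge0 /c ler_pdivlMr; last lra.
  apply: le_trans (logit_ge _ p01).
  by rewrite ler_piMl//; [lra|have := @le_ln1Dx R 1; rewrite -natr1; lra].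
have := ler_wpM2l k0 (ltW Dlt).
have := ler_wpM2l (ltW N0) HS.
lra.
Qed.

End Cosets.

(** * From a unique-sum pair to pairs that disagree on a small set *)

Section Counting.
Context {n : nat}.
Local Notation word := {ffun 'I_n -> bool}.
Implicit Types (x y : word) (p : word * word) (X Y : {set word}) (S : {set 'I_n}).
Local Notation inj_sum X Y :=
  {in finset.setX X Y &, injective (fun p => vsum p.1 p.2)}.

Lemma sum_card_opposite_pairs X Y k :
  (\sum_(S : {set 'I_n} | #|S| == k) #|opposite_pairs X Y S| =
   \sum_(p in finset.setX X Y) 'C(#|disagree p.1 p.2|, k))%N.
Proof.
transitivity (\sum_(S : {set 'I_n} | #|S| == k)
   \sum_(p in finset.setX X Y) (S \subset disagree p.1 p.2))%N.
  apply: eq_bigr => S _; rewrite -sum1_card big_mkcond [RHS]big_mkcond/=.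
  apply: eq_bigr => -[x y] _; rewrite in_opposite_pairs finset.in_setX/=.
  by case: (x \in X); case: (y \in Y); case: (S \subset _).
rewrite exchange_big/=; apply: eq_bigr => p _.
rewrite -cards_draws -sum1_card big_mkcond [RHS]big_mkcond/=.
apply: eq_bigr => S _; rewrite inE andbC.
by case: (#|S| == k); case: (S \subset _).
Qed.

Definition far_pairs X Y : {set word * word} :=
  [set p in finset.setX X Y | (n./2 <= #|disagree p.1 p.2|)%N].

Lemma in_far_pairs X Y p : (p \in far_pairs X Y) =
  (p \in finset.setX X Y) && (n./2 <= #|disagree p.1 p.2|)%N.
Proof. by rewrite [LHS]finset.in_set. Qed.

(** A far pair is opposite on at least [C(n / 2, k)] sets of size [k]. *)
Lemma far_pairs_bound {R : realType} X Y k (b : R) :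
  (#|X| * #|Y| <= 2 * #|far_pairs X Y|)%N ->
  (forall S, #|S| = k -> #|opposite_pairs X Y S|%:R <= b) ->
  (#|X| * #|Y| * 'C(n./2, k))%:R <= 2 * 'C(n, k)%:R * b.
Proof.
move=> XYfar Hb.
have le1 : (#|X| * #|Y| * 'C(n./2, k) <=
    2 * \sum_(S : {set 'I_n} | #|S| == k) #|opposite_pairs X Y S|)%N.
  rewrite sum_card_opposite_pairs.
  apply: (@leq_trans (2 * #|far_pairs X Y| * 'C(n./2, k))).
    by rewrite leq_mul2r XYfar orbT.
  rewrite -mulnA leq_mul2l/= -sum_nat_const.
  rewrite [leqRHS](bigID (mem (far_pairs X Y)))/=.
  apply: leq_trans (leq_addr _ _).
  rewrite [leqRHS](eq_bigl (fun p => p \in far_pairs X Y)); last first.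
    by move=> p; rewrite /= andbC in_far_pairs andbAC andbb.
  apply: leq_sum => p; rewrite in_far_pairs => /andP[_ dp].
  exact: leq_bin2l.
apply: (@le_trans _ _ (2 * \sum_(S : {set 'I_n} | #|S| == k) #|opposite_pairs X Y S|%:R)).
  by rewrite -natr_sum -natrM ler_nat.
rewrite -mulrA ler_pM2l//.
have -> : 'C(n, k)%:R * b = \sum_(S : {set 'I_n} | #|S| == k) b.
  rewrite sumr_const mulr_natl -[in 'C(n, k)](card_ord n) -card_draws.
  by congr (_ *+ _); apply: eq_card => S; rewrite !inE.
by apply: ler_sum => S /eqP; apply: Hb.
Qed.

Definition flip y : word := [ffun i => ~~ y i].

Lemma flipK : involutive flip.
Proof. by move=> y; apply/ffunP => i; rewrite !ffunE negbK. Qed.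

Lemma mem_flip Y y : (y \in flip @: Y) = (flip y \in Y).
Proof. by rewrite -{1}(flipK y) mem_imset//; apply: inv_inj flipK. Qed.

(** [x + flip y = x' + flip y'] is equivalent to [x + y' = x' + y]. *)
Lemma flip_inj_sum X Y : inj_sum X Y -> inj_sum X (flip @: Y).
Proof.
move=> XYinj [x y] [x' y']; rewrite !finset.in_setX !mem_flip.
move=> /andP[xX yY] /andP[xX' yY'] /= /ffunP E.
have [] // : (x, flip y') = (x', flip y).
  apply: XYinj; rewrite ?finset.in_setX ?xX ?xX' ?yY//=.
  apply/ffunP => i; move: (E i); rewrite !ffunE.
  by case: (x i); case: (x' i); case: (y i); case: (y' i).
by move=> -> /(inv_inj flipK) ->.
Qed.

Lemma card_disagree_flip x y : #|disagree x (flip y)| = (n - #|disagree x y|)%N.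
Proof.
rewrite [LHS]cardsCs card_ord; congr (_ - _)%N; apply: eq_card => i.
by rewrite !inE ffunE; case: (x i); case: (y i).
Qed.

(** A pair that is not far becomes far when its second word is flipped. *)
Lemma far_pairs_flip X Y :
  (#|X| * #|Y| <= #|far_pairs X Y| + #|far_pairs X (flip @: Y)|)%N.
Proof.
rewrite -cardsX -(finset.cardsID (far_pairs X Y) (finset.setX X Y)) leq_add//.
  by apply: subset_leq_card; apply: finset.subsetIr.
pose f p := (p.1, flip p.2).
have finj : injective f by move=> [x y] [x' y'] [-> /(inv_inj flipK) ->].
rewrite -(card_imset _ finj); apply: subset_leq_card.
apply/fintype.subsetP => _ /imsetP[[x y] + ->].
rewrite finset.in_setD !in_far_pairs /f/= => /andP[+ xyXY].
rewrite xyXY /= -ltnNge card_disagree_flip => near.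
move: xyXY; rewrite !finset.in_setX mem_flip flipK => ->/=.
lia.
Qed.

Lemma unique_sum_bound {R : realType} X Y k (b : R) : inj_sum X Y ->
  (forall X' Y' S, inj_sum X' Y' -> #|S| = k -> #|opposite_pairs X' Y' S|%:R <= b) ->
  (#|X| * #|Y| * 'C(n./2, k))%:R <= 2 * 'C(n, k)%:R * b.
Proof.
move=> XYinj Hb; have := far_pairs_flip X Y.
have card_flip : #|flip @: Y| = #|Y| by apply: card_imset; apply: inv_inj flipK.
have [far _|near far] := leqP (#|X| * #|Y|) (2 * #|far_pairs X Y|).
  by apply: far_pairs_bound far _ => S; apply: Hb.
rewrite -card_flip; apply: far_pairs_bound => [|S].
  by rewrite card_flip; lia.
by apply: Hb; apply: flip_inj_sum.
Qed.

Lemma max_unique_sum_bound {R : realType} k (p l : R) :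
  0 < p < 1 / 2 -> l = 2 * (p * (1 - p)) -> 1 / 3 <= l -> (k <= n)%N ->
  k%:R * ln 2 <= (n - k)%:R * (ln 2 + entropy l - 2 * entropy p) ->
  (max_unique_sum n * 'C(n./2, k))%:R <=
    2 * 'C(n, k)%:R * expR ((n - k)%:R * (entropy l + (1 - l) * ln 2)).
Proof.
move=> p01 lE l3 kn Hk; rewrite /max_unique_sum.
elim/big_rec: _ => [|[X Y] i /asboolP[_ _ XYinj] Hi].
  by rewrite mul0n !mulr_ge0 ?expR_ge0.
have [_|_] := leqP i (#|X| * #|Y|).
  apply: unique_sum_bound XYinj _.
  move=> X' Y' S XYinj' Sk.
  have Sc : #|~: S| = (n - k)%N by rewrite cardsCs finset.setCK card_ord Sk.
  rewrite -Sc; apply: opposite_pairs_bound p01 lE l3 _ => //.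
  by rewrite Sk Sc.
by [].
Qed.

Lemma max_unique_sum_gt0 : (0 < max_unique_sum n)%N.
Proof.
pose z : word := [ffun=> false].
have zz : `[< unique_sum_pair [set z] [set z] >].
  apply/asboolP; split; try by apply/finset.set0Pn; exists z; rewrite inE.
  move=> [x y] [x' y']; rewrite !finset.in_setX !finset.in_set1.
  by move=> /andP[/eqP -> /eqP ->] /andP[/eqP -> /eqP ->].
by apply: leq_trans (leq_bigmax_cond ([set z], [set z]) zz); rewrite /= !cards1.
Qed.

End Counting.

(** * Asymptotics *)

(** In the binomial expansion of [((N - k) + k) ^ N] the largest of the
[N + 1] terms is the one of index [k]. *)
Lemma expn_le_bin N k : (k <= N)%N ->
  (N ^ N <= N.+1 * ('C(N, k) * ((N - k) ^ (N - k) * k ^ k)))%N.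
Proof.
move=> kN; pose t j := ('C(N, j) * ((N - k) ^ (N - j) * k ^ j))%N.
have step j : (j < N)%N -> (t j.+1 * (j.+1 * (N - k)) = t j * ((N - j) * k))%N.
  move=> jN; have := mul_bin_left N j.
  rewrite /t -(subnSK jN) !expnS.
  move: ((N - k) ^ (N - j.+1))%N (k ^ j)%N 'C(N, j) 'C(N, j.+1) => s w u v E.
  transitivity (j.+1 * v * (s * k * w * (N - k)))%N; first by ring.
  by rewrite E; ring.
have up j : (j < k)%N -> (t j <= t j.+1)%N.
  move=> jk; have jN := leq_trans jk kN.
  have [Nk|Nk] := posnP (N - k).
    by rewrite /t Nk exp0n ?subn_gt0// muln0.
  rewrite -(@leq_pmul2r (j.+1 * (N - k))) ?muln_gt0//= step// leq_mul2l.
  by apply/orP; right; nia.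
have down j : (k <= j)%N -> (j < N)%N -> (t j.+1 <= t j)%N.
  move=> kj jN; have Nk : (0 < N - k)%N by lia.
  rewrite -(@leq_pmul2r (j.+1 * (N - k))) ?muln_gt0//= step// leq_mul2l.
  by apply/orP; right; nia.
have below d : (d <= k)%N -> (t (k - d) <= t k)%N.
  elim: d => [|d IH] dk; first by rewrite subn0.
  apply: leq_trans (IH (ltnW dk)); rewrite -(subnSK dk); apply: up; lia.
have above d : (k + d <= N)%N -> (t (k + d) <= t k)%N.
  elim: d => [|d IH] dN; first by rewrite addn0.
  rewrite addnS in dN *; apply: leq_trans (IH (ltnW dN)); apply: down; lia.
have tk j : (j <= N)%N -> (t j <= t k)%N.
  have [jk _|kj jN] := leqP j k; first by rewrite -(subKn jk) below// leq_subr.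
  by rewrite -(subnKC (ltnW kj)) above// subnKC// ltnW.
rewrite -{1}(subnK kN) expnDn.
apply: (@leq_trans (\sum_(i < N.+1) t k)); last by rewrite sum_nat_const card_ord.
by apply: leq_sum => i _; apply: tk; rewrite -ltnS.
Qed.

Section Binomials.
Context {R : realType}.

(** [C(n, k) a^k (1 - a)^(n - k)] is a term of the expansion of
[(a + (1 - a))^n = 1]. *)
Lemma ln_bin_le n k (a : R) : 0 < a <= 1 / 2 -> (k <= n)%N -> k%:R <= a * n%:R ->
  ln 'C(n, k)%:R <= n%:R * entropy a.
Proof.
move=> /andP[a0 a2] kn kan.
have b0 : 0 < 1 - a by lra.
have C0 : 0 < 'C(n, k)%:R :> R by rewrite ltr0n bin_gt0.
have : 'C(n, k)%:R * ((1 - a) ^+ (n - k) * a ^+ k) <= 1.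
  rewrite -[leRHS](expr1n _ n) -[in leRHS](subrK a 1) [leRHS]exprDn.
  rewrite (bigD1 (Ordinal (kn : (k < n.+1)%N)))//= mulr_natl lerDl.
  by apply: sumr_ge0 => i _; rewrite mulrn_wge0// mulr_ge0// exprn_ge0// ltW.
rewrite -[_ <= 1]ler_ln ?posrE ?mulr_gt0 ?exprn_gt0// ln1.
rewrite !lnM ?posrE ?mulr_gt0 ?exprn_gt0//.
rewrite [ln ((1 - a) ^+ _)]lnXn// [ln (a ^+ _)]lnXn//.
rewrite -[ln (1 - a) *+ _]mulr_natl -[ln a *+ _]mulr_natl natrB//.
have : 0 <= logit a by apply: logit_ge0; rewrite a0.
rewrite /entropy /logit; nra.
Qed.

Lemma ln_bin_ge N k : (0 < k < N)%N ->
  N%:R * entropy (k%:R / N%:R) - ln N.+1%:R <= ln ('C(N, k)%:R : R).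
Proof.
move=> /andP[k0 kN]; have := expn_le_bin N k (ltnW kN).
have N0 : (0 < N)%N by lia.
have Nk0 : (0 < N - k)%N by rewrite subn_gt0.
have C0 : (0 < 'C(N, k))%N by rewrite bin_gt0 ltnW.
rewrite -(ler_nat R) -ler_ln ?posrE ?ltr0n ?muln_gt0 ?expn_gt0 ?N0 ?Nk0 ?k0 ?C0//.
rewrite !natrM !natrX !lnM ?posrE ?mulr_gt0 ?exprn_gt0 ?ltr0n//.
rewrite [ln (_ ^+ N)]lnXn ?ltr0n// [ln (_ ^+ (N - k))]lnXn ?ltr0n//.
rewrite [ln (_ ^+ k)]lnXn ?ltr0n//.
rewrite -[ln _ *+ N]mulr_natl -[ln _ *+ (N - k)]mulr_natl -[ln _ *+ k]mulr_natl.
have -> : N%:R * entropy (k%:R / N%:R) =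
  N%:R * ln N%:R - (N - k)%:R * ln (N - k)%:R - k%:R * ln k%:R :> R.
  have NR0 : N%:R != 0 :> R by rewrite pnatr_eq0 -lt0n.
  have E : 1 - k%:R / N%:R = (N - k)%:R / N%:R :> R.
    by rewrite natrB 1?ltnW//; field.
  rewrite /entropy E !ln_div ?posrE ?ltr0n// natrB 1?ltnW//; field.
  exact: NR0.
lra.
Qed.

Lemma ln_le_sqrt (x : R) : 0 < x -> ln x <= 2 * Num.sqrt x.
Proof.
move=> x0; rewrite -{1}(sqr_sqrtr (ltW x0)) lnXn ?sqrtr_gt0//.
rewrite -[ln _ *+ 2]mulr_natl.
by rewrite ler_pM2l// ltW// ln_sublinear// sqrtr_gt0.
Qed.

Local Open Scope classical_set_scope.

(** An eventual upper bound of the rates bounds [optimal_rate].  Should the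
sequence of rates diverge, its [lim] would be the default value 0, which is at
most [b] since the rates are nonnegative. *)
Lemma optimal_rate_le (v : nat -> R) (b : R) :
  (\forall n \near \oo, rate_seq R n.+1 <= v n) ->
  v n @[n --> \oo] --> b -> optimal_rate R <= b.
Proof.
move=> uv vb.
have u0 n : 0 <= rate_seq R n.
  by rewrite /rate_seq /log2 !divr_ge0// ?ln_ge0// ?ler1n ?max_unique_sum_gt0.
have b0 : 0 <= b.
  apply: (cvgr_to_ge vb); near=> n; apply: (le_trans (u0 n.+1)).
  by near: n.
have [/cvg_ex[/= l ul]|Ndiv] := pselect (cvg (rate_seq R n @[n --> \oo])).
  rewrite /optimal_rate (cvg_lim _ ul)//.
  by apply: (ler_cvg_to _ vb uv); rewrite cvg_shiftS.
by rewrite /optimal_rate dvgP.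
Unshelve. all: by end_near. Qed.

End Binomials.

Section Limit.
Context {R : realType}.
Variables (a l p : R).
Hypotheses (a_gt0 : 0 < a) (a_le : a <= 1 / 4) (p01 : 0 < p < 1 / 2).
Hypotheses (lE : l = 2 * (p * (1 - p))) (l_ge : 1 / 3 <= l).
Hypothesis gap : ln 2 + entropy l - 2 * entropy p = a / (1 - a) * ln 2.

Let a_lt1 : 0 < 1 - a. Proof. by move: a_le; lra. Qed.
Let a_le2 : a <= 1 / 2. Proof. by move: a_le; lra. Qed.

(* The index j stands for the length n = j + 1, so that 1 / n is harmonic j. *)
Let k (j : nat) : nat := Num.truncn (a * j.+1%:R).
Let h (j : nat) : nat := (j.+1)./2.
Let rk (j : nat) : R := (k j)%:R / j.+1%:R.
Let rh (j : nat) : R := (h j)%:R / j.+1%:R.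
Let eps (j : nat) : R := ln (h j).+1%:R / j.+1%:R.
Let G : R := entropy l + (1 - l) * ln 2.
Let bound (j : nat) : R :=
  (ln 2 * harmonic j + entropy a - rh j * entropy (rk j / rh j) + eps j
     + (1 - rk j) * G) / ln 2.

Let k_itv j : (k j)%:R <= a * j.+1%:R < (k j).+1%:R.
Proof. by apply: truncn_itv; rewrite mulr_ge0// ltW. Qed.

Let rate_seq_le j : (2 < j)%N -> a^-1 <= j%:R -> rate_seq R j.+1 <= bound j.
Proof.
move=> j2 ja; have /andP[kan _] := k_itv j; set n := j.+1 in kan *.
have n0 : 0 < n%:R :> R by rewrite ltr0n.
have kn4 : (4 * k j <= n)%N.
  by rewrite -(ler_nat R) natrM; have := ler_wpM2r (ltW n0) a_le; lra.
have k0 : (0 < k j)%N.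
  rewrite truncn_gt0 -(ler_pM2l (_ : 0 < a^-1)) ?invr_gt0// mulr1 mulKf ?gt_eqF//.
  by apply: le_trans ja _; rewrite ler_nat.
have [kh kn] : (k j < h j)%N /\ (k j <= n)%N.
  by move: (k j) kn4 j2; rewrite /h /n; clear => i; lia.
have M0 : 0 < (max_unique_sum n)%:R :> R by rewrite ltr0n max_unique_sum_gt0.
have C0 : 0 < 'C(n, k j)%:R :> R by rewrite ltr0n bin_gt0.
have C'0 : 0 < 'C(h j, k j)%:R :> R by rewrite ltr0n bin_gt0 ltnW.
have := @max_unique_sum_bound n R (k j) p l p01 lE l_ge kn.
rewrite gap mulrA ler_pM2r ?ln2_gt0// => /(_ _).
rewrite -[_ <= _ * expR _]ler_ln ?posrE ?mulr_gt0 ?expR_gt0 ?ltr0n ?muln_gt0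
  ?max_unique_sum_gt0 ?bin_gt0 ?kn ?(ltnW kh)//.
rewrite natrM !lnM ?posrE ?mulr_gt0 ?expR_gt0// expRK -/G => HM.
have {}HM : ln (max_unique_sum n)%:R + ln 'C(h j, k j)%:R <=
   ln 2 + ln 'C(n, k j)%:R + (n - k j)%:R * G.
  (* Since k is a n rounded down, k <= (n - k) a / (1 - a). *)
  apply: HM; rewrite natrB// mulrA ler_pdivlMr//.
  nra.
have Hn : ln 'C(n, k j)%:R <= n%:R * entropy a.
  by apply: ln_bin_le => //; rewrite a_gt0.
have Hh : (h j)%:R * entropy ((k j)%:R / (h j)%:R) - ln (h j).+1%:R <=
    ln ('C(h j, k j)%:R : R).
  by apply: ln_bin_ge; rewrite k0.
rewrite /rate_seq /log2 /bound mulrAC ler_pM2r ?invr_gt0 ?ln2_gt0// ler_pdivrMr//.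
have h0 : (h j)%:R != 0 :> R by rewrite pnatr_eq0 -lt0n (leq_ltn_trans _ kh).
have -> : rk j / rh j = (k j)%:R / (h j)%:R.
  by rewrite /rk /rh; field; rewrite h0 gt_eqF.
set E := entropy (_ / _) in Hh *.
have -> : (ln 2 * harmonic j + entropy a - rh j * E + eps j + (1 - rk j) * G)
    * n%:R = ln 2 + n%:R * entropy a - (h j)%:R * E + ln (h j).+1%:R
      + (n%:R - (k j)%:R) * G.
  by rewrite /rh /rk /eps /harmonic /= -/n; field; rewrite gt_eqF.
by rewrite natrB// in HM; lra.
Qed.

Local Open Scope classical_set_scope.

Let cvg_of_dist (u : nat -> R) (b : R) :
  (forall j, `|u j - b| <= harmonic j) -> u j @[j --> \oo] --> b.
Proof.
move=> ub; have H0 := @cvg_harmonic R.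
apply: (@squeeze_cvgr _ _ _ _ (fun j => b - harmonic j) (fun j => b + harmonic j)).
- near=> j; have := ub j; rewrite ler_norml => /andP[? ?]; apply/andP; split; lra.
- by rewrite -[X in _ --> X]subr0; apply: cvgB => //; apply: cvg_cst.
- by rewrite -[X in _ --> X]addr0; apply: cvgD => //; apply: cvg_cst.
Unshelve. all: by end_near. Qed.

Let rk_cvg : rk j @[j --> \oo] --> a.
Proof.
apply: cvg_of_dist => j; have n0 : 0 < j.+1%:R :> R by rewrite ltr0n.
have /andP[kl kr] := k_itv j; rewrite -natr1 in kr.
rewrite -(ler_pM2r n0) /harmonic /= mulVf ?gt_eqF//.
rewrite -[X in _ * X](gtr0_norm n0) -normrM mulrBl /rk divfK ?gt_eqF//.
by rewrite ler_norml; apply/andP; split; lra.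
Qed.

Let rh_cvg : rh j @[j --> \oo] --> (1 / 2 : R).
Proof.
apply: cvg_of_dist => j; have n0 : 0 < j.+1%:R :> R by rewrite ltr0n.
have hE : (odd j.+1)%:R + 2 * (h j)%:R = j.+1%:R :> R.
  by rewrite -natrM -natrD mul2n odd_double_half.
have /andP[odd0 odd1] : 0 <= ((odd j.+1)%:R : R) <= 1 by rewrite ler0n lern1 leq_b1.
rewrite -(ler_pM2r n0) /harmonic /= mulVf ?gt_eqF//.
rewrite -[X in _ * X](gtr0_norm n0) -normrM mulrBl /rh divfK ?gt_eqF//.
by rewrite ler_norml; apply/andP; split; lra.
Qed.

Let eps_cvg : eps j @[j --> \oo] --> (0 : R).
Proof.
have H0 := @cvg_harmonic R.
apply: (@squeeze_cvgr _ _ _ _ (fun=> 0) (fun j => 2 * Num.sqrt (harmonic j))).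
- near=> j; have n0 : 0 < j.+1%:R :> R by rewrite ltr0n.
  rewrite /eps divr_ge0 ?ln_ge0 ?ler1n//= ler_pdivrMr//.
  have -> : Num.sqrt (j.+1%:R^-1) = Num.sqrt j.+1%:R / j.+1%:R :> R.
    rewrite sqrtrV ?ltW// -[X in _ / X](sqr_sqrtr (ltW n0)); field.
    by rewrite gt_eqF// sqrtr_gt0.
  rewrite -mulrA divfK ?gt_eqF//; apply: le_trans (ln_le_sqrt _ n0).
  by rewrite ler_ln ?posrE ?ltr0n// ler_nat /h; lia.
- exact: cvg_cst.
- have E0 : 2 * Num.sqrt 0 = 0 :> R by rewrite sqrtr0 mulr0.
  rewrite -[X in _ --> X]E0.
  apply: cvgM; first exact: cvg_cst.
  by apply: continuous_cvg => //; apply: sqrt_continuous.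
Unshelve. all: by end_near. Qed.

Lemma optimal_rate_le_limit : optimal_rate R <=
  (entropy a - 1 / 2 * entropy (2 * a) + (1 - a) * G) / ln 2.
Proof.
apply: (@optimal_rate_le _ bound).
  near=> j; apply: rate_seq_le; near: j; first exact: nbhs_infty_gt.
  exact: nbhs_infty_ger.
apply: cvgM; last exact: cvg_cst.
apply: cvgD; last first.
  by apply: cvgM; [apply: cvgB => //|]; apply: cvg_cst.
rewrite -[X in _ --> X]addr0; apply: cvgD => //.
apply: cvgB.
  have E0 : ln 2 * 0 + entropy a = entropy a by rewrite mulr0 add0r.
  rewrite -[X in _ --> X]E0; apply: cvgD; last exact: cvg_cst.
  by apply: cvgM; [exact: cvg_cst|exact: cvg_harmonic].
apply: cvgM => //.
have -> : 2 * a = a / (1 / 2) by field.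
apply: continuous_cvg.
  by apply: continuous_entropy; apply/andP; split; move: a_gt0 a_le; lra.
by apply: cvgM => //; apply: cvgV => //; lra.
Unshelve. all: by end_near. Qed.

End Limit.

(** * The function Gamma and its inverse *)

Section GammaInverse.
Context {R : realType}.
Implicit Types a l b : R.

(** The root [p] in [0, 1/2] of [2 p (1 - p) = l]: two independent bits of
mean [p] differ with probability [l]. *)
Definition half_root l : R := (1 - Num.sqrt (1 - 2 * l)) / 2.

Lemma half_rootE l : l <= 1 / 2 -> 2 * (half_root l * (1 - half_root l)) = l.
Proof.
move=> l2; have /sqr_sqrtr : 0 <= 1 - 2 * l by lra.
rewrite /half_root; set s := Num.sqrt _ => sE.
transitivity ((1 - s ^+ 2) / 2); first by field.
by rewrite sE; field.
Qed.

Lemma half_root_itv l : 0 < l < 1 / 2 -> 0 < half_root l < 1 / 2.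
Proof.
move=> /andP[l0 l2]; have s0 : 0 < Num.sqrt (1 - 2 * l) by rewrite sqrtr_gt0; lra.
have s1 : Num.sqrt (1 - 2 * l) < 1 by rewrite -[ltRHS]sqrtr1 ltr_sqrt; lra.
by rewrite /half_root; apply/andP; split; lra.
Qed.

Lemma GammaE l : Gamma l = (ln 2 + entropy l - 2 * entropy (half_root l)) / ln 2.
Proof.
by rewrite /Gamma !entropy2E -/(half_root l); field; rewrite gt_eqF// ln2_gt0.
Qed.

Lemma ln_expn_lt m n : (2 ^ m < 3 ^ n)%N -> m%:R * ln 2 < n%:R * ln 3 :> R.
Proof.
rewrite -(ltr_nat R) !natrX -[_ ^+ m < _]ltr_ln ?posrE ?exprn_gt0// !mulr_natl.
by rewrite [ln (_ ^+ m)]lnXn// [ln (_ ^+ n)]lnXn.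
Qed.

(** In natural logarithms the claim is [2 entropy p < ln 3] where
[p (1 - p) = 1/6].  The tangent of [entropy_tangent] at [1/4] bounds the left
side by [4 ln 2 - (19/12) ln 3], so that [2^11 < 3^7] concludes. *)
Lemma Gamma_third : 1 / 3 < Gamma (1 / 3 : R).
Proof.
have l2 := @ln2_gt0 R; rewrite GammaE ltr_pdivlMr//.
set p := half_root _.
have p01 : 0 < p < 1 / 2 by apply: half_root_itv; apply/andP; split; lra.
have pE : p * (1 - p) = 1 / 6.
  have := half_rootE (1 / 3); rewrite -/p; lra.
have e3 : entropy (1 / 3) = ln 3 - 2 / 3 * ln 2 :> R.
  rewrite /entropy (_ : 1 - 1 / 3 = 2 / 3); last by field.
  by rewrite !ln_div ?posrE// ln1; field.
have l4 : logit (1 / 4) = ln 3 :> R.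
  rewrite /logit -ln_div ?posrE; try lra.
  by congr ln; field.
have q01 : 0 < (1 / 4 : R) < 1 / 2 by apply/andP; split; lra.
have p1 : 0 <= p <= 1 by move: p01 => /andP[? ?]; apply/andP; split; lra.
have := entropy_tangent _ _ q01 p1; rewrite pE l4 entropy_quarter.
have : 11%:R * ln 2 < 7%:R * ln 3 :> R by apply: ln_expn_lt.
rewrite e3.
rewrite (_ : ln 3 / (1 - 2 * (1 / 4)) * (1 / 6 - 1 / 4 * (1 - 1 / 4)) =
  - (ln 3 / 24) :> R); last by field.
lra.
Qed.

Lemma Gamma_half : Gamma (1 / 2 : R) = 0.
Proof.
rewrite GammaE /half_root (_ : 1 - 2 * (1 / 2) = 0); last by field.
by rewrite sqrtr0 subr0 entropy_half; field; rewrite gt_eqF// ln2_gt0.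
Qed.

Local Open Scope classical_set_scope.

Lemma continuous_entropy2 a : 0 < a < 1 -> {for a, continuous (@entropy2 R)}.
Proof.
move=> a01; have -> : @entropy2 R = (fun x : R => entropy x / ln 2).
  by apply/funext => x; exact: entropy2E.
by apply: cvgM; [exact: continuous_entropy|exact: cvg_cst].
Qed.

Lemma continuous_Gamma l : 1 / 3 <= l <= 1 / 2 -> {for l, continuous (@Gamma R)}.
Proof.
move=> /andP[l3 l2].
have s1 : Num.sqrt (1 - 2 * l) < 1 by rewrite -[ltRHS]sqrtr1 ltr_sqrt; lra.
have s0 := sqrtr_ge0 (1 - 2 * l).
have p01 : 0 < half_root l < 1 by rewrite /half_root; apply/andP; split; lra.
apply: cvgB.
  apply: cvgD; first exact: cvg_cst.
  by apply: continuous_entropy2; apply/andP; split; lra.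
apply: cvgM; first exact: cvg_cst.
apply: (@continuous_cvg _ _ _ _ _ half_root (@entropy2 R) (half_root l)).
  exact: continuous_entropy2.
apply: cvgM; last exact: cvg_cst.
apply: cvgB; first exact: cvg_cst.
apply: (@continuous_cvg _ _ _ _ _ (fun x : R => 1 - 2 * x) Num.sqrt (1 - 2 * l)).
  exact: sqrt_continuous.
apply: cvgB; first exact: cvg_cst.
by apply: cvgM; [exact: cvg_cst|exact: cvg_id].
Qed.

(** By the intermediate value theorem [0, 1/3] is in the range of [Gamma] on
[1/3, 1/2]. *)
Lemma Gamma_invP b : 0 <= b <= 1 / 3 ->
  1 / 3 <= Gamma_inv b <= 1 / 2 /\ Gamma (Gamma_inv b) = b.
Proof.
move=> /andP[b0 b3].
have surj : set_surj [set l : R | 1 / 3 <= l <= 1 / 2] [set b] (@Gamma R).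
  have G3 := Gamma_third.
  have le32 : 1 / 3 <= 1 / 2 :> R by lra.
  have cont : {within `[1 / 3, 1 / 2], continuous (@Gamma R)}.
    apply: continuous_in_subspaceT => x; rewrite inE => /itvP xI.
    by apply: continuous_Gamma; rewrite !xI.
  have bI : Num.min (Gamma (1 / 3)) (Gamma (1 / 2)) <= b
      <= Num.max (Gamma (1 / 3)) (Gamma (1 / 2) : R).
    by rewrite Gamma_half ge_min le_max b0 orbT /=; apply/orP; left; lra.
  move=> _ ->; have [c] := IVT le32 cont bI.
  by move=> /itvP cI <-; exists c => //=; rewrite !cI.
split; last by apply: (surjpK _ surj); rewrite inE.
have /(_ (Gamma_inv b)) := @surjpinv_image_sub R R (fun=> 0) _ _ _ surj.
by apply; exists b.
Qed.

(** Gibbs' inequality against the uniform law on three letters. *)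
Lemma ternary_entropy_lt l : 0 < l < 1 -> l != 1 / 3 ->
  entropy l + (1 - l) * ln 2 < ln 3.
Proof.
move=> /andP[l0 l1] l3.
have l1' : 0 < 1 - l by lra.
have x0 : 0 < 1 / (3 * l) by rewrite divr_gt0// mulr_gt0.
have y0 : 0 < 2 / (3 * (1 - l)) by rewrite divr_gt0// mulr_gt0.
have H1 : ln (1 / (3 * l)) < 1 / (3 * l) - 1.
  rewrite -ltr_expR lnK ?posrE// -[ltLHS](subrKC 1) expR_gt1Dx//.
  apply: contra_neq l3 => /eqP; rewrite subr_eq add0r => /eqP lE.
  have : 1 / (3 * l) * (3 * l) = 1 by field; rewrite gt_eqF.
  rewrite lE; lra.
have H2 : ln (2 / (3 * (1 - l))) <= 2 / (3 * (1 - l)) - 1.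
  by rewrite -ler_expR lnK ?posrE// -[leLHS](subrKC 1) expR_ge1Dx.
have := ltr_pM2l l0 (ln (1 / (3 * l))) (1 / (3 * l) - 1); rewrite H1.
have := ler_pM2l l1' (ln (2 / (3 * (1 - l)))) (2 / (3 * (1 - l)) - 1); rewrite H2.
rewrite !ln_div ?posrE ?mulr_gt0// !lnM ?posrE// ln1.
have -> : l * (1 / (3 * l) - 1) = 1 / 3 - l by field; rewrite gt_eqF.
have -> : (1 - l) * (2 / (3 * (1 - l)) - 1) = 2 / 3 - (1 - l) by field; rewrite gt_eqF.
rewrite /entropy; lra.
Qed.

Lemma rate_boundE a : rate_bound a =
  (entropy a - 1 / 2 * entropy (2 * a) + (1 - a) *
    (entropy (Gamma_inv (a / (1 - a))) + (1 - Gamma_inv (a / (1 - a))) * ln 2)) / ln 2.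
Proof. by rewrite /rate_bound !entropy2E; field; rewrite gt_eqF// ln2_gt0. Qed.

Lemma optimal_rate_le_rate_bound a : 0 < a <= 1 / 4 -> optimal_rate R <= rate_bound a.
Proof.
move=> /andP[a0 a4]; have a1 : 0 < 1 - a by lra.
have b0 : 0 < a / (1 - a) by rewrite divr_gt0.
have [|] := Gamma_invP (a / (1 - a)).
  by rewrite (ltW b0) ler_pdivrMr//=; lra.
rewrite rate_boundE; set l := Gamma_inv _ => /andP[l3 l2] lE.
have {}l2 : l < 1 / 2.
  rewrite lt_neqAle l2 andbT; apply: contraPneq lE => ->.
  by rewrite Gamma_half => /esym/eqP; rewrite gt_eqF.
apply: (@optimal_rate_le_limit R a l (half_root l)) => //.
- by apply: half_root_itv; apply/andP; split; lra.
- by rewrite half_rootE// ltW.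
- by rewrite -lE GammaE divfK// gt_eqF// ln2_gt0.
Qed.

Lemma rate_bound_quarter_lt : rate_bound (1 / 4 : R) < 3 / 2.
Proof.
rewrite rate_boundE (_ : 1 / 4 / (1 - 1 / 4) = 1 / 3); last by field.
have [|] := Gamma_invP (1 / 3); first by apply/andP; split; lra.
set l := Gamma_inv _ => /andP[l3 l2] lE.
have lN3 : l != 1 / 3.
  by apply: contraPneq lE => ->; apply/eqP; rewrite gt_eqF// Gamma_third.
have l01 : 0 < l < 1 by apply/andP; split; lra.
have := ternary_entropy_lt _ l01 lN3.
rewrite (_ : 2 * (1 / 4) = 1 / 2); last by field.
rewrite ltr_pdivrMr ?ln2_gt0// entropy_quarter entropy_half; lra.
Qed.

End GammaInverse.

Local Open Scope classical_set_scope.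
Local Open Scope ring_scope.

Theorem mainTheorem2 (R : realType) :
  [/\ optimal_rate R <= inf [set rate_bound a | a in [set a : R | 0 < a <= 1 / 4]],
      inf [set rate_bound a | a in [set a : R | 0 < a <= 1 / 4]]
        <= rate_bound (1 / 4 : R)
    & rate_bound (1 / 4 : R) < 3 / 2].
Proof.
have q : 0 < (1 / 4 : R) <= 1 / 4 by apply/andP; split; lra.
split; last exact: rate_bound_quarter_lt.
  apply: lb_le_inf; first by exists (rate_bound (1 / 4)), (1 / 4).
  by move=> _ [a a_itv <-]; exact: optimal_rate_le_rate_bound.
apply: ge_inf; last by exists (1 / 4).
exists (optimal_rate R) => _ [a a_itv <-]; exact: optimal_rate_le_rate_bound.
Qed.
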